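(* Let $n,m\in\mathbb{N}$. The set $\Phi_1(\mathcal{U}(\mathbb{R}^n,\mathbb{R}^m))$ of finite elements of the vector lattice $\mathcal{U}(\mathbb{R}^n,\mathbb{R}^m)$ coincides with the set of all operators $T=(T_{i,j})\in\mathcal{U}(\mathbb{R}^n,\mathbb{R}^m)$ for which each function $T_{i,j}\colon\mathbb{R}\to\mathbb{R}$ ($i=1,\ldots,m$; $j=1,\ldots,n$) satisfies $T_{i,j}(0)=0$ and $\operatorname{supp}(T_{i,j})\subset[a^{(ij)},b^{(ij)}]$ for some real interval $[a^{(ij)},b^{(ij)}]$. In this case $\Phi_1(\mathcal{U}(\mathbb{R}^n,\mathbb{R}^m))=\Phi_2(\mathcal{U}(\mathbb{R}^n,\mathbb{R}^m))$ also holds.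
   Context: $\mathbb{R}^n$ and $\mathbb{R}^m$ are vector lattices with the coordinate-wise order. For vector lattices $E,F$, an operator $T\colon E\to F$ is orthogonally additive if $T(x+y)=T(x)+T(y)$ whenever $|x|\wedge|y|=0$; it is order bounded if it maps order bounded subsets of $E$ into order bounded subsets of $F$. $\mathcal{U}(E,F)$ is the set of all (not necessarily linear) orthogonally additive order bounded operators $E\to F$ (abstract Uryson operators), ordered by $S\le T$ iff $S(x)\le T(x)$ for all $x\in E$; it is a Dedekind complete vector lattice when $F$ is Dedekind complete. A map $T\colon\mathbb{R}^n\to\mathbb{R}^m$ belongs to $\mathcal{U}(\mathbb{R}^n,\mathbb{R}^m)$ if and only if there are functions $T_{i,j}\colon\mathbb{R}\to\mathbb{R}$ ($1\le i\le m$, $1\le j\le n$) with $T_{i,j}(0)=0$, each mapping bounded intervals to bounded sets, such that the $i$-th coordinate of $T(x)$ is $(T(x))_i=\sum_{j=1}^n T_{i,j}(x_j)$ for $x=(x_1,\dots,x_n)$; in this case one writes $T=(T_{i,j})$. For $f\colon\mathbb{R}\to\mathbb{R}$, $\operatorname{supp}(f)=\{x\in\mathbb{R}: f(x)\ne0\}$ (no closure taken). In an Archimedean vector lattice $G$, an element $\varphi\in G$ is finite if there is $z\in G$ (a majorant of $\varphi$) such that for every $x\in G$ there is a number $c_x>0$ with $|x|\wedge n|\varphi|\le c_x z$ for all $n\in\mathbb{N}$. $\varphi$ is totally finite if it is finite and has a majorant that is itself a finite element. $\Phi_1(G)$ and $\Phi_2(G)$ are the sets of finite and totally finite elements of $G$.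 *)

(* Defs.v *)
From HB Require Import structures.
From mathcomp Require Import all_boot all_order all_algebra.
From mathcomp Require Import boolp classical_sets functions reals.

Set Implicit Arguments.
Unset Strict Implicit.
Unset Printing Implicit Defensive.

Import Order.TTheory GRing.Theory Num.Theory.
Local Open Scope classical_set_scope.
Local Open Scope ring_scope.

(** * Vector lattices *)

(* [meet] and [join] are fields here because a structure joining
   [GRing.Lmodule] with [Order.Lattice] cannot be added on top of
   [Num.RealDomain], which already inherits additive and lattice structures *)
HB.mixin Record isVectorLattice (R : realType) V
    of GRing.Lmodule R V & Order.POrder ring_display V := {
  vl_meet : V -> V -> V ;
  vl_join : V -> V -> V ;
  vl_meetP : forall x y z : V, (x <= vl_meet y z) = (x <= y) && (x <= z) ;
  vl_joinP : forall x y z : V, (vl_join x y <= z) = (x <= z) && (y <= z) ;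
  vl_leD2r : forall z x y : V, x <= y -> x + z <= y + z ;
  vl_leZ : forall (a : R) (x y : V), 0 <= a -> x <= y -> a *: x <= a *: y
}.

#[short(type="vectorLatticeType")]
HB.structure Definition VectorLattice (R : realType) :=
  { V of isVectorLattice R V & GRing.Lmodule R V & Order.POrder ring_display V }.

HB.mixin Record VectorLattice_isArchimedean (R : realType) V
    of VectorLattice R V := {
  vl_archimedean : forall x y : V, (forall k : nat, x *+ k <= y) -> x <= 0
}.

#[short(type="archVectorLatticeType")]
HB.structure Definition ArchVectorLattice (R : realType) :=
  { V of VectorLattice_isArchimedean R V & VectorLattice R V }.

Definition modulus (R : realType) (V : vectorLatticeType R) (x : V) : V :=
  vl_join x (- x).

Definition order_bounded_set (d : Order.disp_t) (V : porderType d) (A : set V) :=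
  exists a b : V, forall x, A x -> (a <= x <= b)%O.

(** * Finite and totally finite elements *)

Section FiniteElements.
Context {R : realType} {G : archVectorLatticeType R}.

Definition majorant (phi z : G) : Prop :=
  forall x : G, exists2 c : R, 0 < c &
    forall k : nat, vl_meet (modulus x) (modulus phi *+ k) <= c *: z.

Definition finite_elements : set G :=
  [set phi | exists z, majorant phi z].

Definition totally_finite_elements : set G :=
  [set phi | exists2 z, majorant phi z & finite_elements z].

End FiniteElements.
Arguments finite_elements {R} G.
Arguments totally_finite_elements {R} G.

(** * Abstract Uryson operators *)

Section UrysonPred.
Context {R : realType} {E F : vectorLatticeType R}.

Definition orthogonally_additive (T : E -> F) : Prop :=
  forall x y, vl_meet (modulus x) (modulus y) = 0 -> T (x + y) = T x + T y.

Definition order_bounded_operator (T : E -> F) : Prop :=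
  forall A : set E, order_bounded_set A -> order_bounded_set (T @` A).

Definition uryson_pred : {pred E -> F} :=
  mem [set T | orthogonally_additive T /\ order_bounded_operator T].

End UrysonPred.

(* U(E, F) *)
Record uryson (R : realType) (E F : vectorLatticeType R) := Uryson {
  uryson_fun :> E -> F ;
  uryson_funP : uryson_fun \in uryson_pred }.

Section UrysonModule.
Context {R : realType} {E F : vectorLatticeType R}.

HB.instance Definition _ := [isSub for @uryson_fun R E F].
HB.instance Definition _ := [Choice of uryson E F by <:].

Lemma uryson_predP (T : E -> F) :
  reflect (orthogonally_additive T /\ order_bounded_operator T)
          (T \in uryson_pred).
Proof. by apply: (iffP idP); rewrite inE. Qed.

Lemma vl_leD (x y z t : F) : x <= y -> z <= t -> x + z <= y + t.
Proof.
move=> xy zt; apply: le_trans (vl_leD2r _ _ _ xy) _.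
by rewrite ![y + _]addrC; exact: vl_leD2r.
Qed.

Lemma vl_leN (x y : F) : x <= y -> - y <= - x.
Proof.
by move=> /(vl_leD2r (- x - y)); rewrite addrA subrr add0r addrCA subrr addr0.
Qed.

Fact uryson_submod_closed : submod_closed (@uryson_pred R E F).
Proof.
split.
  apply/uryson_predP; split=> [x y _|A _]; first by rewrite addr0.
  by exists 0, 0 => _ [x _ <-]; rewrite !lexx.
move=> a T S /uryson_predP[T1 T2] /uryson_predP[S1 S2].
apply/uryson_predP; split=> [x y xy|A Abd].
  change (a *: T (x + y) + S (x + y) = a *: T x + S x + (a *: T y + S y)).
  by rewrite T1// S1// scalerDr addrACA.
have [b1 [c1 h1]] := T2 _ Abd; have [b2 [c2 h2]] := S2 _ Abd.
have k1 x : A x -> b1 <= T x <= c1 by move=> Ax; apply: h1; exists x.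
have k2 x : A x -> b2 <= S x <= c2 by move=> Ax; apply: h2; exists x.
have [a0|/ltW a0] := leP 0 a.
  exists (a *: b1 + b2), (a *: c1 + c2) => _ [x Ax <-].
  have /andP[? ?] := k1 _ Ax; have /andP[? ?] := k2 _ Ax.
  by apply/andP; split; apply: vl_leD => //; exact: vl_leZ.
have Na0 : 0 <= - a by rewrite oppr_ge0.
exists (a *: c1 + b2), (a *: b1 + c2) => _ [x Ax <-].
have /andP[? ?] := k1 _ Ax; have /andP[? ?] := k2 _ Ax.
have h (u v : F) : u <= v -> a *: v <= a *: u.
  by move=> uv; rewrite -[a]opprK !(scaleNr (- a)); apply: vl_leN; exact: vl_leZ.
by apply/andP; split; apply: vl_leD => //; exact: h.
Qed.

HB.instance Definition _ := GRing.isSubmodClosed.Build R (E -> F)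
  (@uryson_pred R E F) uryson_submod_closed.
HB.instance Definition _ := [SubChoice_isSubLmodule of uryson E F by <:].

(* the pointwise order; its display has to be [ring_display] so that
   [uryson E F] can be an ordered module *)
HB.instance Definition _ :=
  [SubChoice_isSubPOrder of uryson E F by <: with ring_display].

Lemma uryson_leP (S T : uryson E F) :
  reflect (forall x, S x <= T x) (S <= T).
Proof. exact: lefP. Qed.

Lemma uryson_leD2r (U S T : uryson E F) : S <= T -> S + U <= T + U.
Proof. by move=> /uryson_leP ST; apply/uryson_leP => x; exact: (@vl_leD2r R F (U x) _ _ (ST x)). Qed.

Lemma uryson_leZ (a : R) (S T : uryson E F) :
  0 <= a -> S <= T -> a *: S <= a *: T.
Proof. by move=> a0 /uryson_leP ST; apply/uryson_leP => x; exact: (@vl_leZ R F a _ _ a0 (ST x)). Qed.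

End UrysonModule.

(** * Coordinatewise order on matrices, hence on [R^n = 'rV[R]_n] *)

Section MatrixOrder.
Context {R : realType} {m n : nat}.
Implicit Types A B C : 'M[R]_(m, n).

Definition mx_le A B := [forall i, forall j, A i j <= B i j].

Lemma mx_leP A B : reflect (forall i j, A i j <= B i j) (mx_le A B).
Proof.
apply: (iffP forallP) => [h i j|h i]; last by apply/forallP => j.
by move/forallP: (h i).
Qed.

Fact mx_le_refl : reflexive mx_le.
Proof. by move=> A; apply/mx_leP. Qed.

Fact mx_le_anti : antisymmetric mx_le.
Proof.
move=> A B /andP[/mx_leP AB /mx_leP BA]; apply/matrixP => i j.
by apply/eqP; rewrite eq_le AB BA.
Qed.

Fact mx_le_trans : transitive mx_le.
Proof.
move=> B A C /mx_leP AB /mx_leP BC; apply/mx_leP => i j.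
exact: le_trans (AB i j) (BC i j).
Qed.

HB.instance Definition _ := Order.Le_isPOrder.Build ring_display 'M[R]_(m, n)
  mx_le_refl mx_le_anti mx_le_trans.

Definition mx_meet A B := \matrix_(i, j) Num.min (A i j) (B i j).
Definition mx_join A B := \matrix_(i, j) Num.max (A i j) (B i j).

Fact mx_meetP A B C : (A <= mx_meet B C) = (A <= B) && (A <= C).
Proof.
apply/mx_leP/andP => [h|[/mx_leP AB /mx_leP AC] i j].
  by split; apply/mx_leP => i j; move: (h i j); rewrite mxE le_min => /andP[].
by rewrite mxE le_min AB AC.
Qed.

Fact mx_joinP A B C : (mx_join A B <= C) = (A <= C) && (B <= C).
Proof.
apply/mx_leP/andP => [h|[/mx_leP AB /mx_leP AC] i j].
  by split; apply/mx_leP => i j; move: (h i j); rewrite mxE ge_max => /andP[].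
by rewrite mxE ge_max AB AC.
Qed.

Fact mx_leD2r C A B : A <= B -> A + C <= B + C.
Proof. by move=> /mx_leP h; apply/mx_leP => i j; rewrite !mxE lerD2r. Qed.

Fact mx_leZ (a : R) A B : 0 <= a -> A <= B -> a *: A <= a *: B.
Proof.
by move=> a0 /mx_leP h; apply/mx_leP => i j; rewrite !mxE ler_wpM2l.
Qed.

HB.instance Definition _ := isVectorLattice.Build R 'M[R]_(m, n)
  mx_meetP mx_joinP mx_leD2r mx_leZ.

Lemma mx_modulusE A i j : modulus A i j = `|A i j|.
Proof.
rewrite [LHS]mxE mxE; case: (ger0P (A i j)) => h.
  by apply/max_idPl; rewrite (le_trans _ h)// oppr_le0.
by apply/max_idPr; rewrite (le_trans (ltW h))// oppr_ge0 ltW.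
Qed.

Lemma real_archimedean (x y : R) : (forall k : nat, x *+ k <= y) -> x <= 0.
Proof.
move=> h; rewrite leNgt; apply/negP => x0.
have y0 : 0 <= y by have := h 0; rewrite mulr0n.
have := archi_boundP (divr_ge0 y0 (ltW x0)).
by rewrite ltNge ler_pdivlMr// mulr_natl h.
Qed.

Fact mx_archimedean A B : (forall k : nat, A *+ k <= B) -> A <= 0.
Proof.
move=> h; apply/mx_leP => i j; rewrite mxE; apply: (@real_archimedean _ (B i j)).
by move=> k; have /mx_leP/(_ i j) := h k; rewrite mulmxnE.
Qed.

HB.instance Definition _ :=
  VectorLattice_isArchimedean.Build R 'M[R]_(m, n) mx_archimedean.

End MatrixOrder.

(** * Matrix representation of the operators in [U(R^n, R^m)] *)

Section MatrixRepresentation.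
Context {R : realType} {n m : nat}.
Implicit Types (A : 'I_m -> 'I_n -> R -> R) (T S : uryson 'rV[R]_n 'rV[R]_m).

Definition mxop A (x : 'rV[R]_n) : 'rV[R]_m :=
  \row_i \sum_j A i j (x 0 j).

Definition uryson_kernel A : Prop := forall i j, A i j 0 = 0 /\
  forall a b : R, order_bounded_set (A i j @` [set t | a <= t <= b]).

(* [T = (T_{i,j})] *)
Definition represented_by T A : Prop :=
  uryson_kernel A /\ forall x, T x = mxop A x.

(* [T_{i,j} t = (T (t e_j))_i] *)
Definition entry T (i : 'I_m) (j : 'I_n) (t : R) : R :=
  T (t *: delta_mx 0 j) 0 i.

Lemma mx_disjointP (x y : 'rV[R]_n) :
  vl_meet (modulus x) (modulus y) = 0 <-> forall j, x 0 j = 0 \/ y 0 j = 0.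
Proof.
split=> [/matrixP h j|h].
  have := h 0 j; rewrite [LHS]mxE !mx_modulusE mxE.
  by case: leP => _ /eqP; rewrite normr_eq0 => /eqP; [left|right].
apply/matrixP => i j; rewrite ord1 [LHS]mxE !mx_modulusE mxE.
by case: (h j) => ->; rewrite normr0; [apply/min_idPl|apply/min_idPr].
Qed.

Lemma uryson_orthoadd T (x y : 'rV[R]_n) :
  (forall j, x 0 j = 0 \/ y 0 j = 0) -> T (x + y) = T x + T y.
Proof. by move=> /mx_disjointP; case/uryson_predP: (uryson_funP T) => + _; apply. Qed.

Lemma uryson0 T : T 0 = 0.
Proof.
have := @uryson_orthoadd T 0 0; rewrite addr0 => h.
have /eqP := h (fun j => or_introl (mxE _ _ _ _)).
by rewrite -subr_eq subrr eq_sym => /eqP.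
Qed.

Lemma entry_kernel T : uryson_kernel (entry T).
Proof.
move=> i j; rewrite /entry scale0r uryson0 mxE; split=> // a b.
have [_ Tbd] := uryson_predP _ (uryson_funP T).
have [] := Tbd [set x | exists2 t, a <= t <= b & x = t *: delta_mx 0 j].
  exists (\row_k Num.min (a * (k == j)%:R) 0), (\row_k Num.max (b * (k == j)%:R) 0).
  move=> _ [t /andP[at_ tb] ->]; apply/andP; split; apply/mx_leP => p k;
    rewrite ord1 !mxE eqxx /=; case: eqP => _;
    by rewrite ?mulr1 ?mulr0 ?ge_min ?le_max ?lexx ?at_ ?tb ?orbT.
move=> c [d h]; exists (c 0 i), (d 0 i) => _ [t tab <-].
have /andP[/mx_leP h1 /mx_leP h2] : c <= T (t *: delta_mx 0 j) <= d.
  by apply: h; exists (t *: delta_mx 0 j) => //; exists t.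
by rewrite h1 h2.
Qed.

Lemma entryE T x : T x = mxop (entry T) x.
Proof.
have h (s : seq 'I_n) : uniq s ->
    T (\sum_(j <- s) x 0 j *: delta_mx 0 j) =
    \sum_(j <- s) T (x 0 j *: delta_mx 0 j).
  elim: s => [|k s ih] /=; first by rewrite !big_nil uryson0.
  move=> /andP[ks us]; rewrite !big_cons uryson_orthoadd ?ih// => j.
  have [->|jk] := eqVneq j k.
    right; rewrite summxE big_seq big1// => l ls.
    rewrite !mxE eqxx /= (_ : (k == l) = false) ?mulr0//.
    by apply/negbTE; apply: contraNneq ks => ->.
  by left; rewrite !mxE (negbTE jk) andbF mulr0.
rewrite {1}(row_sum_delta x) h ?index_enum_uniq//.
by apply/rowP => i; rewrite mxE summxE.
Qed.

Lemma kernel_bounded A (c d : 'rV[R]_n) i j : uryson_kernel A ->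
  exists ab : R * R, forall x : 'rV[R]_n, c <= x <= d ->
    ab.1 <= A i j (x 0 j) <= ab.2.
Proof.
move=> /(_ i j)[_ /(_ (c 0 j) (d 0 j))[a [b h]]]; exists (a, b) => x.
move=> /andP[/mx_leP cx /mx_leP xd]; apply: h; exists (x 0 j) => //=.
by rewrite cx xd.
Qed.

Lemma mxop_uryson A : uryson_kernel A -> mxop A \in uryson_pred.
Proof.
move=> Ak; apply/uryson_predP; split=> [x y /mx_disjointP xy|B [c [d cd]]].
  apply/rowP => i; rewrite !mxE -big_split /=; apply: eq_bigr => j _.
  by rewrite mxE; case: (xy j) => ->; have [-> _] := Ak i j; rewrite !(add0r, addr0).
have /choice[f hf] (ij : 'I_m * 'I_n) := kernel_bounded c d ij.1 ij.2 Ak.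
exists (\row_i \sum_j (f (i, j)).1), (\row_i \sum_j (f (i, j)).2).
move=> _ [x Bx <-]; apply/andP.
by split; apply/mx_leP => p i; rewrite !mxE; apply: ler_sum => j _;
  have /andP[] := hf (i, j) _ (cd _ Bx).
Qed.

Definition uryson_of A (Ak : uryson_kernel A) : uryson 'rV[R]_n 'rV[R]_m :=
  Uryson (mxop_uryson Ak).

Lemma mxop_delta A i j t : uryson_kernel A ->
  mxop A (t *: delta_mx 0 j) 0 i = A i j t.
Proof.
move=> Ak; rewrite mxE (bigD1 j)//= big1 ?addr0 => [|k kj].
  by rewrite !mxE !eqxx mulr1.
by rewrite !mxE (negbTE kj) andbF mulr0; have [] := Ak i k.
Qed.

Lemma uryson_entry_leP S T :
  reflect (forall i j t, entry S i j t <= entry T i j t) (S <= T).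
Proof.
apply: (iffP (uryson_leP _ _)) => [h i j t|h x].
  by have /mx_leP/(_ 0 i) := h (t *: delta_mx 0 j).
by rewrite !entryE; apply/mx_leP => p i; rewrite !mxE; apply: ler_sum.
Qed.

Lemma kernel2 (f : R -> R -> R) S T : f 0 0 = 0 ->
  (forall x y z, z <= x -> z <= y -> z <= f x y) ->
  (forall x y z, x <= z -> y <= z -> f x y <= z) ->
  uryson_kernel (fun i j t => f (entry S i j t) (entry T i j t)).
Proof.
move=> f0 fl fu i j.
have [S0 Sb] := entry_kernel S i j; have [T0 Tb] := entry_kernel T i j.
split=> [|a b]; first by rewrite S0 T0.
have [s1 [s2 hs]] := Sb a b; have [t1 [t2 ht]] := Tb a b.
exists (Num.min s1 t1), (Num.max s2 t2) => _ [t tab <-].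
have /andP[h1 h2] : s1 <= entry S i j t <= s2 by apply: hs; exists t.
have /andP[h3 h4] : t1 <= entry T i j t <= t2 by apply: ht; exists t.
by apply/andP; split; [apply: fl|apply: fu];
  rewrite ?ge_min ?le_max ?h1 ?h2 ?h3 ?h4 ?orbT.
Qed.

Fact min_kernel S T :
  uryson_kernel (fun i j t => Num.min (entry S i j t) (entry T i j t)).
Proof.
apply: kernel2 => [|x y z|x y z zx zy]; first exact: minxx.
- by rewrite le_min => -> ->.
- by rewrite ge_min zx.
Qed.

Fact max_kernel S T :
  uryson_kernel (fun i j t => Num.max (entry S i j t) (entry T i j t)).
Proof.
apply: kernel2 => [|x y z zx zy|x y z]; first exact: maxxx.
- by rewrite le_max zx.
- by rewrite ge_max => -> ->.
Qed.

Definition uryson_meet S T := uryson_of (min_kernel S T).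
Definition uryson_join S T := uryson_of (max_kernel S T).

Lemma entry_of A (Ak : uryson_kernel A) i j t :
  entry (uryson_of Ak) i j t = A i j t.
Proof. exact: mxop_delta. Qed.

Fact uryson_meetP S T U : (S <= uryson_meet T U) = (S <= T) && (S <= U).
Proof.
apply/uryson_entry_leP/andP => [h|[/uryson_entry_leP h1 /uryson_entry_leP h2] i j t].
  by split; apply/uryson_entry_leP => i j t; move: (h i j t);
    rewrite entry_of le_min => /andP[].
by rewrite entry_of le_min h1 h2.
Qed.

Fact uryson_joinP S T U : (uryson_join S T <= U) = (S <= U) && (T <= U).
Proof.
apply/uryson_entry_leP/andP => [h|[/uryson_entry_leP h1 /uryson_entry_leP h2] i j t].
  by split; apply/uryson_entry_leP => i j t; move: (h i j t);
    rewrite entry_of ge_max => /andP[].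
by rewrite entry_of ge_max h1 h2.
Qed.

HB.instance Definition _ := isVectorLattice.Build R
  (uryson 'rV[R]_n 'rV[R]_m)
  uryson_meetP uryson_joinP uryson_leD2r uryson_leZ.

Lemma urysonMn T (k : nat) (x : 'rV[R]_n) : (T *+ k) x = T x *+ k.
Proof. by elim: k => // k ih; rewrite !mulrS -ih. Qed.

Fact uryson_archimedean S T : (forall k : nat, S *+ k <= T) -> S <= 0.
Proof.
move=> h; apply/uryson_leP => x.
apply: (@vl_archimedean R 'rV[R]_m (S x) (T x)) => k.
by have /uryson_leP/(_ x) := h k; rewrite urysonMn.
Qed.

HB.instance Definition _ := VectorLattice_isArchimedean.Build R
  (uryson 'rV[R]_n 'rV[R]_m) uryson_archimedean.

End MatrixRepresentation.

(* no closure is taken *)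
Definition supp (R : realType) (f : R -> R) : set R := [set t | f t != 0].

(* Main.v *)
Require Import Defs.
From mathcomp Require Import all_boot all_order all_algebra.
From mathcomp Require Import boolp classical_sets functions reals.

(** The lattice operations of U(R^n, R^m) act entry by entry, so everything is
    read off from the functions [entry T i j]. Since the multiples of a nonzero
    real exhaust R, the meets of |x| with k |phi| increase to |x| exactly on
    the supports of the entries of phi. Hence Z is a majorant of phi if and
    only if Z is nonnegative and every operator x is dominated, on those
    supports, by a multiple of Z ([majorant_entryP]).

    If Z is a majorant, testing with the entries |t| (|Z_ij t| + 1), which are
    again bounded on bounded intervals, yields |t| (Z_ij t + 1) <= c Z_ij t on
    the supports, so |t| <= c there: the supports are bounded. Conversely, an
    operator x is bounded on bounded supports, hence dominated there by a
    multiple of their indicator functions, which form a majorant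
    ([majorant_supp_indicator]). This majorant has the same supports as phi, so
    it is finite for the same reason, and phi is totally finite. *)

Set Implicit Arguments.
Unset Strict Implicit.
Unset Printing Implicit Defensive.

Import Order.TTheory GRing.Theory Num.Theory.
Local Open Scope classical_set_scope.
Local Open Scope ring_scope.

Lemma norm_le_max (R : realDomainType) (a b t : R) :
  a <= t <= b -> `|t| <= Num.max `|a| `|b|.
Proof.
move=> /andP[at_ tb]; rewrite ler_norml (le_trans tb) ?le_max ?ler_norm ?orbT//.
by rewrite andbT (le_trans _ at_)// lerNl le_max -normrN ler_norm.
Qed.

Section Entries.
Context {R : realType} {n m : nat}.
Implicit Types (T S x phi : uryson 'rV[R]_n 'rV[R]_m).

Lemma entryZ (c : R) T i j t : entry (c *: T) i j t = c * entry T i j t.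
Proof. by rewrite /entry [LHS]mxE. Qed.

Lemma entryN T i j t : entry (- T) i j t = - entry T i j t.
Proof. by rewrite -scaleN1r entryZ mulN1r. Qed.

Lemma entryMn T k i j t : entry (T *+ k) i j t = entry T i j t *+ k.
Proof. by rewrite /entry urysonMn mulmxnE. Qed.

Lemma entry_meet S T i j t :
  entry (vl_meet S T) i j t = Num.min (entry S i j t) (entry T i j t).
Proof. exact: entry_of. Qed.

Lemma entry_modulus T i j t : entry (modulus T) i j t = `|entry T i j t|.
Proof.
rewrite [LHS]entry_of entryN; case: (ger0P (entry T i j t)) => h.
  by apply/max_idPl; rewrite (le_trans _ h)// oppr_le0.
by apply/max_idPr; rewrite (le_trans (ltW h))// oppr_ge0 ltW.
Qed.

Lemma represented_entry T A i j t :
  represented_by T A -> entry T i j t = A i j t.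
Proof. by move=> [Ak TA]; rewrite /entry TA mxop_delta. Qed.

Lemma kernel_norm_bounded (A : 'I_m -> 'I_n -> R -> R) i j (a b : R) :
  uryson_kernel A ->
  exists2 M, 0 <= M & forall t, a <= t <= b -> `|A i j t| <= M.
Proof.
move=> /(_ i j)[_ /(_ a b)[p [q h]]].
exists (Num.max `|p| `|q|) => [|t tab]; first by rewrite le_max normr_ge0.
by apply: norm_le_max; apply: h; exists t.
Qed.

Lemma uryson_kernel_norm (A : 'I_m -> 'I_n -> R -> R) :
  (forall i j, A i j 0 = 0) ->
  (forall i j (a b : R), exists M, forall t, a <= t <= b -> `|A i j t| <= M) ->
  uryson_kernel A.
Proof.
move=> A0 Ab i j; split=> // a b; have [M hM] := Ab i j a b.
by exists (- M), M => _ [t tab <-]; rewrite -ler_norml hM.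
Qed.

(** By the Archimedean property, k |phi_ij t| exceeds |x_ij t| for large k as
    soon as phi_ij t is nonzero, so bounding all the meets amounts to bounding
    |x| on the supports. *)
Lemma majorant_entryP phi (Z : uryson 'rV[R]_n 'rV[R]_m) :
  majorant phi Z <->
  (forall i j t, 0 <= entry Z i j t) /\
  forall x, exists2 c : R, 0 < c & forall i j t,
    entry phi i j t != 0 -> `|entry x i j t| <= c * entry Z i j t.
Proof.
have meetE x c k : vl_meet (modulus x) (modulus phi *+ k) <= c *: Z <->
    forall i j t, Num.min `|entry x i j t| (`|entry phi i j t| *+ k)
      <= c * entry Z i j t.
  split=> [/uryson_entry_leP h i j t|h].
    by have := h i j t; rewrite entry_meet entryMn !entry_modulus entryZ.
  apply/uryson_entry_leP => i j t.
  by rewrite entry_meet entryMn !entry_modulus entryZ.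
split=> [h|[Z0 h] x].
  split=> [i j t|x].
    have [c c0 /(_ 0)/meetE/(_ i j t)] := h phi.
    by rewrite mulr0n min_r// pmulr_rge0.
  have [c c0 hc] := h x; exists c => // i j t; rewrite -normr_gt0 => phi0.
  have := archi_boundP (divr_ge0 (normr_ge0 (entry x i j t)) (ltW phi0)).
  rewrite ltr_pdivrMr// mulr_natl => /ltW xk.
  by have /meetE/(_ i j t) := hc (Num.bound (`|entry x i j t| / `|entry phi i j t|));
    rewrite min_l.
have [c c0 hc] := h x; exists c => // k; apply/meetE => i j t.
have [->|/hc] := eqVneq (entry phi i j t) 0.
  by rewrite normr0 mul0rn min_r// mulr_ge0// ltW.
by apply: le_trans; rewrite ge_min lexx.
Qed.

Definition bounded_supports T : Prop := forall i j, exists a b : R,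
  a <= b /\ supp (entry T i j) `<=` [set t | a <= t <= b].

(** The test operator has to outgrow every multiple of the majorant Z at
    infinity, which the factor |t| achieves; the added 1 keeps it nonzero where
    Z vanishes, and makes the final comparison strict. One constant c then
    confines the support to [- c, c]. *)
Lemma finite_bounded_supports T :
  finite_elements (uryson 'rV[R]_n 'rV[R]_m) T -> bounded_supports T.
Proof.
move=> [Z /majorant_entryP[Z0 hZ]] i j.
have Xk : uryson_kernel (fun i j t => `|t| * (`|entry Z i j t| + 1)).
  apply: uryson_kernel_norm => [k l|k l a b]; first by rewrite normr0 mul0r.
  have [M M0 hM] := @kernel_norm_bounded _ k l a b (entry_kernel Z).
  exists (Num.max `|a| `|b| * (M + 1)) => t tab.
  rewrite normrM normr_id (@ger0_norm _ (_ + 1)) ?addr_ge0//.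
  apply: ler_pM; rewrite ?addr_ge0 ?lerD2r ?hM//.
  exact: norm_le_max.
have [c c0 hc] := hZ (uryson_of Xk).
exists (- c), c; split=> [|t /hc]; first by apply: (@le_trans _ _ 0); rewrite ?oppr_le0 ltW.
rewrite entry_of (ger0_norm (Z0 i j t)) normrM normr_id.
rewrite (@ger0_norm _ (_ + 1)) ?addr_ge0// => h /=.
rewrite -ler_norml leNgt; apply/negP => ct.
have Z1 : 0 < entry Z i j t + 1 by rewrite ltr_wpDl.
have := lt_le_trans (_ : c * (entry Z i j t + 1) < _) h.
rewrite ltr_pM2r// => /(_ ct).
by rewrite ltr_pM2l// ltNge lerDl ler01.
Qed.

Lemma supp_indicator_kernel T :
  uryson_kernel (fun i j t => (entry T i j t != 0)%:R : R).
Proof.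
apply: uryson_kernel_norm => [i j|i j a b].
  by have [-> _] := entry_kernel T i j; rewrite eqxx.
by exists 1 => t _; case: eqP; rewrite ?normr0 ?normr1.
Qed.

Definition supp_indicator T := uryson_of (supp_indicator_kernel T).

Lemma supp_indicator_neq0 T i j t :
  (entry (supp_indicator T) i j t != 0) = (entry T i j t != 0).
Proof. by rewrite entry_of pnatr_eq0 eqb0 negbK. Qed.

Lemma bounded_supports_indicator T :
  bounded_supports T -> bounded_supports (supp_indicator T).
Proof.
move=> h i j; have [a [b [ab hab]]] := h i j; exists a, b; split=> // t.
by rewrite /supp /= supp_indicator_neq0 => /hab.
Qed.

(** An operator is bounded on each of the finitely many supports; the sum of
    these bounds is a single constant for all entries, and the added 1 makes it
    positive. *)
Lemma majorant_supp_indicator T :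
  bounded_supports T -> majorant T (supp_indicator T).
Proof.
move=> Tb; apply/majorant_entryP; split=> [i j t|x].
  by rewrite entry_of ler0n.
have /choice[M hM] (ij : 'I_m * 'I_n) : exists M : R, 0 <= M /\
    forall t, entry T ij.1 ij.2 t != 0 -> `|entry x ij.1 ij.2 t| <= M.
  have [a [b [_ hab]]] := Tb ij.1 ij.2.
  have [M M0 xM] := @kernel_norm_bounded _ ij.1 ij.2 a b (entry_kernel x).
  by exists M; split=> // t /hab; exact: xM.
have M0 ij : 0 <= M ij by have [] := hM ij.
exists (1 + \sum_ij M ij) => [|i j t T0]; first by rewrite ltr_wpDr// sumr_ge0.
rewrite entry_of T0 mulr1; have [_ /(_ t T0)/le_trans] := hM (i, j); apply.
by rewrite (bigD1 (i, j))//= addrCA lerDl addr_ge0// sumr_ge0.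
Qed.

Lemma finite_elementsP T :
  finite_elements (uryson 'rV[R]_n 'rV[R]_m) T <-> bounded_supports T.
Proof.
split; first exact: finite_bounded_supports.
by move=> Tb; exists (supp_indicator T); exact: majorant_supp_indicator.
Qed.

End Entries.

Theorem proposition3p2 (R : realType) (n m : nat) :
  finite_elements (uryson 'rV[R]_n 'rV[R]_m) =
    [set T : uryson 'rV[R]_n 'rV[R]_m |
      exists A : 'I_m -> 'I_n -> R -> R,
        represented_by T A /\
        forall (i : 'I_m) (j : 'I_n),
          A i j 0 = 0 /\
          exists a b : R, a <= b /\ supp (A i j) `<=` [set t | a <= t <= b]]
  /\
  finite_elements (uryson 'rV[R]_n 'rV[R]_m) =
    totally_finite_elements (uryson 'rV[R]_n 'rV[R]_m).
Proof.
split; apply/seteqP; split=> T.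
- move=> /finite_elementsP Tb; exists (entry T); split.
    by split; [exact: entry_kernel|exact: entryE].
  by move=> i j; split; [have [] := entry_kernel T i j|exact: Tb].
- move=> [A [TA hA]]; apply/finite_elementsP => i j.
  have [_ [a [b [ab hab]]]] := hA i j; exists a, b; split=> // t.
  by rewrite /supp /= (represented_entry _ _ _ TA) => /hab.
- move=> /finite_elementsP Tb; exists (supp_indicator T).
    exact: majorant_supp_indicator.
  by apply/finite_elementsP; exact: bounded_supports_indicator.
- by move=> [Z TZ _]; exists Z.
Qed.
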